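(* Let $N>1$. The boundary arcs of the connected fundamental domain $\bigcup_{\gamma\in\Theta}\gamma\overline{D}$ for $\Gamma_0(N)$ satisfy the following gluing patterns, where $i,j$ range over $A=\{-N_1,\dots,N_2\}$. 1. $ST^{N_2}L\sim ST^{-N_1}R$. 2. For $\gcd(i,N)=1$, $ST^iB\sim ST^{\widetilde{-i^{-1}}}B$. 3. For $\gcd(j,N)>1$: (a) $ST^jST^{M_j}L\sim ST^{\widetilde{(1-jW_j)^{-1}j}}SR$; (b) for each $1\le m\le M_j$ there are $j'\in A$ with $\gcd(j',N)>1$ and $1\le m'\le M_{j'}$ satisfying $$jj'+(jm-1)(j'm'-1)\equiv0\pmod N,$$ and for such $j',m'$ one has $ST^jST^mB\sim ST^{j'}ST^{m'}B$.
   Context: $\mathbb{H}$ is the upper half plane, with $\Gamma(1)=SL_2(\mathbb{Z})$ acting by Möbius transformations, $S=\begin{pmatrix}0&-1\\1&0\end{pmatrix}$, $T=\begin{pmatrix}1&1\\0&1\end{pmatrix}$. Put $N_1=\lfloor (N-1)/2\rfloor$, $N_2=\lfloor N/2\rfloor$, and $A=\{-N_1,\dots,N_2\}$, a set of consecutive integers representing $\mathbb{Z}/N$. For $x\in\mathbb{Z}$ (or $x\in\mathbb{Z}/N$), $\widetilde{x}$ is the unique integer in $A$ congruent to $x$ mod $N$; inverses under the tilde, such as $i^{-1}$ and $(1-jW_j)^{-1}$, are taken in $(\mathbb{Z}/N)^*$. With $\mathbb{N}=\mathbb{Z}_{>0}$ define, for $j\in\mathbb{Z}/N$ (and for an integer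 $j$ via its class), $$W_j=\min\{m\in\mathbb{N}\mid mj-1\in(\mathbb{Z}/N)^*\},\qquad M_j=W_j-1.$$ By convention $\gcd(0,N)=N$. The set $$\Theta=\{ST^i\mid i\in A\}\cup\{ST^jST^m\mid j\in A,\ \gcd(j,N)>1,\ 0\le m\le M_j\}$$ is (known to be) a set of right coset representatives for $\Gamma_0(N)\backslash\Gamma(1)$, and $\bigcup_{\gamma\in\Theta}\gamma\overline{D}$ is a connected fundamental domain for $\Gamma_0(N)$, where $D=\{z\in\mathbb{H}\mid |z|>1,\ |\operatorname{Re}z|<1/2\}$ and $\overline{D}$ is its closure in $\mathbb{H}$. The edges of $\overline D$ are $$L=\{z\in\mathbb{H}\mid\operatorname{Re}z=1/2,\ |z|\ge1\},\quad R=\{z\in\mathbb{H}\mid\operatorname{Re}z=-1/2,\ |z|\ge1\},\quad B=\{z\in\mathbb{H}\mid|z|=1,\ |\operatorname{Re}z|\le1/2\}.$$ Two arcs $C_1,C_2$ are equivalent, written $C_1\sim C_2$, if there is $g\in\Gamma_0(N)$ with $C_1=gC_2$. The boundary arcs of the fundamental domain are: $ST^{N_2}L$, $ST^{-N_1}R$; $ST^iB$ for $i\in A$, $\gcd(i,N)=1$; and, for $j\in A$ with $\gcd(j,N)>1$, the arcs $ST^jSR$, $ST^jST^{M_j}L$ and $ST^jST^mB$ ($1\le m\le M_j$). *)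

(* Defs.v *)
From HB Require Import structures.
From mathcomp Require Import all_boot all_order all_algebra.
From mathcomp Require Import boolp classical_sets reals complex.
From mathcomp Require Import zify.

Set Implicit Arguments.
Unset Strict Implicit.
Unset Printing Implicit Defensive.

Import Order.TTheory GRing.Theory Num.Theory.

Local Open Scope ring_scope.
Local Open Scope complex_scope.
Local Open Scope classical_set_scope.

Section Modular.

Definition mx2 (a b c d : int) : 'M[int]_2 :=
  \matrix_(i, j) nth 0 (nth [::] [:: [:: a; b]; [:: c; d]] i) j.

Definition S : 'M[int]_2 := mx2 0 (-1) 1 0.
Definition T : 'M[int]_2 := mx2 1 1 0 1.

Definition Gamma0 (N : nat) : set 'M[int]_2 :=
  [set g : 'M[int]_2 | \det g = 1 /\ (N%:Z %| g 1%R 0%R)%Z].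

Variable R : realType.

Definition upper_half_plane : set R[i] := [set z | 0 < complex.Im z].

(* The denominator never vanishes on the upper half plane when [\det g = 1]. *)
Definition moebius (g : 'M[int]_2) (z : R[i]) : R[i] :=
  ((g 0 0)%:~R * z + (g 0 1)%:~R) / ((g 1 0)%:~R * z + (g 1 1)%:~R).

Definition act (g : 'M[int]_2) (C : set R[i]) : set R[i] := moebius g @` C.

Definition arc_equiv (N : nat) (C1 C2 : set R[i]) : Prop :=
  exists2 g, Gamma0 N g & C1 = act g C2.

(* [`|z|] is the modulus as an element of [R[i]], whose order is partial:
   [1 <= `|z|] compares two real elements. *)
Definition edgeL : set R[i] :=
  upper_half_plane `&` [set z | complex.Re z = 1 / 2 /\ 1 <= `|z|].
Definition edgeR : set R[i] :=
  upper_half_plane `&` [set z | complex.Re z = - (1 / 2) /\ 1 <= `|z|].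
Definition edgeB : set R[i] :=
  upper_half_plane `&` [set z | `|z| = 1 /\ `|complex.Re z| <= 1 / 2].

End Modular.
Arguments edgeL {R}.
Arguments edgeR {R}.
Arguments edgeB {R}.

Section Residues.

Variable N : nat.

Definition N1 : nat := ((N - 1) %/ 2)%N.
Definition N2 : nat := (N %/ 2)%N.

Definition A : {pred int} := [pred i : int | - N1%:Z <= i <= N2%:Z].

(* Meaningful for [1 < N] only: see [tildeP]. *)
Definition tilde (x : 'Z_N) : int :=
  if (x <= N2)%N then x%:Z else x%:Z - N%:Z.

Lemma tildeP (x : 'Z_N) (a : int) :
  (1 < N)%N -> (a \in A /\ a%:~R = x) <-> a = tilde x.
Proof.
move=> N1lt.
have NR0 : (N%:~R : 'Z_N) = 0 by rewrite -pmulrn pchar_Zp.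
have xlt : (x < N)%N by rewrite -[X in (_ < X)%N](Zp_cast N1lt) ltn_ord.
have tR : (tilde x)%:~R = x.
  by rewrite /tilde; case: ifP => _; rewrite ?intrB ?NR0 ?subr0 -pmulrn natr_Zp.
have tA : tilde x \in A.
  by rewrite /tilde; case: ifP; rewrite inE /N1 /N2; lia.
split=> [[aA aR]|->]; last by [].
have inj k : (k < N)%N -> (k%:R : 'Z_N) = 0 -> k = 0%N.
  by move=> kN /(congr1 val) /=; rewrite val_Zp_nat // modn_small.
have d0 : ((a - tilde x)%:~R : 'Z_N) = 0 by rewrite intrB aR tR subrr.
have dN : (`|a - tilde x| < N)%N.
  by move: aA tA; rewrite !inE /N1 /N2; lia.
suff : `|a - tilde x|%N = 0%N by lia.
apply: inj => //.
move: d0; rewrite {1}(intEsign (a - tilde x)) intrM rmorph_sign.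
by case: (_ < 0) => /= /eqP; rewrite ?expr0 ?expr1 ?mul1r ?mulN1r ?oppr_eq0 => /eqP.
Qed.

Lemma W_exists (j : 'Z_N) :
  exists m, (0 < m)%N && (m%:R * j - 1 \is a GRing.unit).
Proof.
exists (Zp_trunc N).+2; rewrite /=.
have -> : ((Zp_trunc N).+2%:R : 'Z_N) = 0.
  exact: (@pchar_Zp (Zp_trunc N).+2).
by rewrite mul0r sub0r unitrN unitr1.
Qed.

(* The integer argument [j] of the W_j of the text enters as [j%:~R : 'Z_N],
   and 'Z_N is Z/N only for [1 < N]. *)
Definition W (j : 'Z_N) : nat := ex_minn (W_exists j).
Definition M (j : 'Z_N) : nat := (W j - 1)%N.

End Residues.

(* Main.v *)
(* Since L = TR and SB = B, each gluing compares g C with h C for an explicit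
   pair g, h in SL_2(Z), and these are equivalent as soon as g h^-1 is in
   Gamma_0(N), a congruence on the lower rows of g and h. The existence in 3(b)
   is a statement about the projective line over Z/N: with c = jm - 1, which is
   not a unit because m < W_j, the point (c : -j) equals (j' : j'm' - 1) for the
   least m' with u = m'c + j a unit and j' = c/u. Such an m' exists because c and
   j are coprime; m' > 0 because j is not a unit; and m' < W_j', since
   otherwise (m' - W_j') c + j = - u (W_j' j' - 1) would be a unit, against the
   minimality of m'. *)

Require Import Defs.
From HB Require Import structures.
From mathcomp Require Import all_boot all_order all_algebra.
From mathcomp Require Import boolp classical_sets reals complex.
From mathcomp Require Import zify ring lra.

Import Order.TTheory GRing.Theory Num.Theory.

Local Open Scope ring_scope.

(** * Integer matrices and words in [S] and [T] *)

Lemma mx2_eta (g : 'M[int]_2) : g = mx2 (g 0 0) (g 0 1) (g 1 0) (g 1 1).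
Proof.
by apply/matrixP => -[[|[|//]] Hi] -[[|[|//]] Hj];
  rewrite mxE /=; congr (g _ _); apply/val_inj.
Qed.

Lemma mul_mx2 a b c d a' b' c' d' :
  mx2 a b c d * mx2 a' b' c' d' =
  mx2 (a * a' + b * c') (a * b' + b * d') (c * a' + d * c') (c * b' + d * d').
Proof.
by apply/matrixP => -[[|[|//]] Hi] -[[|[|//]] Hj];
  rewrite !mxE !big_ord_recl big_ord0 !mxE /= addr0.
Qed.

Lemma det_mx2 a b c d : \det (mx2 a b c d) = a * d - b * c.
Proof.
rewrite (expand_det_row _ ord0) !big_ord_recl big_ord0 /cofactor !det_mx11.
by rewrite !mxE /=; ring.
Qed.

Lemma T_expz (i : int) : T ^ i = mx2 1 i 0 1.
Proof.
have TX (n : nat) : T ^+ n = mx2 1 n%:Z 0 1.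
  elim: n => [|n IHn].
    by rewrite expr0 [LHS]mx2_eta !mxE.
  rewrite exprS IHn mul_mx2; congr mx2; lia.
case: i => n; first exact: TX.
rewrite NegzE -exprnN TX.
have E1 : mx2 1 n.+1%:Z 0 1 * mx2 1 (- n.+1%:Z) 0 1 = 1.
  rewrite mul_mx2 [RHS]mx2_eta !mxE /=; congr mx2; lia.
have E2 : mx2 1 (- n.+1%:Z) 0 1 * mx2 1 n.+1%:Z 0 1 = 1.
  rewrite mul_mx2 [RHS]mx2_eta !mxE /=; congr mx2; lia.
have U : mx2 1 n.+1%:Z 0 1 \is a GRing.unit.
  by apply/unitrP; exists (mx2 1 (- n.+1%:Z) 0 1).
by rewrite -[LHS]mulr1 -E1 mulKr.
Qed.

Lemma ST_expz (i : int) : S * T ^ i = mx2 0 (-1) 1 i.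
Proof. by rewrite T_expz mul_mx2; congr mx2; lia. Qed.

Lemma STS_expz (j m : int) : S * T ^ j * S * T ^ m = mx2 (-1) (- m) j (j * m - 1).
Proof. by rewrite ST_expz T_expz !mul_mx2; congr mx2; lia. Qed.

(** * The Möbius action on arcs and edges *)

Section Arcs.
Variable R : realType.
Implicit Types (C : set R[i]) (g h : 'M[int]_2).
Local Open Scope classical_set_scope.

Lemma moebiusM g h (z : R[i]) : \det h = 1 -> 0 < complex.Im z ->
  moebius (g * h) z = moebius g (moebius h z).
Proof.
rewrite (mx2_eta g) (mx2_eta h).
move: (g 0 0) (g 0 1) (g 1 0) (g 1 1) => a b c d.
move: (h 0 0) (h 0 1) (h 1 0) (h 1 1) => a' b' c' d'.
rewrite det_mx2 mul_mx2 /moebius !mxE /= => det1 Imz.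
(* As the imaginary part of [z] is positive, a zero denominator forces [c' = 0] and then [d' = 0],
   against determinant one. *)
have q0 : c'%:~R * z + d'%:~R != 0.
  case: z Imz => x y /= Imz; apply/eqP; rewrite -!(rmorph_int (real_complex R)) => E.
  have /eqP : c'%:~R * y + 0 * x + 0 = 0 := congr1 (@complex.Im R) E.
  have : c'%:~R * x - 0 * y + d'%:~R = 0 := congr1 (@complex.Re R) E.
  rewrite !mul0r subr0 !addr0 => E1.
  rewrite mulf_eq0 (gt_eqF Imz) orbF intr_eq0 => /eqP c0.
  move: E1; rewrite c0 mul0r add0r => /eqP; rewrite intr_eq0 => /eqP d0.
  by move: det1; rewrite c0 d0; lia.
rewrite !rmorphD !rmorphM /=.
set q := c'%:~R * z + d'%:~R in q0 *.
set p := a'%:~R * z + b'%:~R.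
(* Numerator and denominator of the outer quotient both get the denominator [q], which then
   cancels. *)
have E (u v : R[i]) : u * (p / q) + v = (u * p + v * q) / q.
  by field.
rewrite !E invf_div mulrA divfK //.
by congr (_ / _); rewrite /p /q; ring.
Qed.

Lemma actM g h C : \det h = 1 -> C `<=` @upper_half_plane R ->
  act (g * h) C = act g (act h C).
Proof.
move=> h1 CH; apply/seteqP; split=> [_ [z Cz <-]|_ [_ [z Cz <-] <-]].
  by rewrite moebiusM //; [exists (moebius h z) => //; exists z | exact: CH].
by exists z => //; rewrite moebiusM //; exact: CH.
Qed.

(* The lower left entry of [g * h^-1] is a determinant of the lower rows. *)
Lemma arc_equiv_act (N : nat) a b c d a' b' c' d' C :
  a * d - b * c = 1 -> a' * d' - b' * c' = 1 ->
  (c * d' - d * c' = 0 %[mod N%:Z])%Z -> C `<=` @upper_half_plane R ->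
  arc_equiv N (act (mx2 a b c d) C) (act (mx2 a' b' c' d') C).
Proof.
move=> g1 h1 gh CH.
exists (mx2 a b c d * mx2 d' (- b') (- c') a').
  rewrite mul_mx2; split.
    rewrite det_mx2; transitivity ((a * d - b * c) * (a' * d' - b' * c')); first ring.
    by rewrite g1 h1.
  rewrite mxE /= mulrN; apply/dvdz_mod0P; rewrite gh mod0z //.
rewrite -actM ?det_mx2 //; congr act.
(* Multiplying the left entry by [1 = a' * d' - b' * c'] makes the equality a polynomial
   identity. *)
by rewrite !mul_mx2; congr mx2; rewrite -[LHS]mulr1 -h1; ring.
Qed.

Lemma edgeL_upper : edgeL `<=` @upper_half_plane R. Proof. by move=> z []. Qed.
Lemma edgeR_upper : edgeR `<=` @upper_half_plane R. Proof. by move=> z []. Qed.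
Lemma edgeB_upper : edgeB `<=` @upper_half_plane R. Proof. by move=> z []. Qed.

Lemma moebiusT (z : R[i]) : moebius T z = z + 1.
Proof. by rewrite /moebius !mxE /= mul1r mul0r add0r divr1. Qed.

(** Between the lines of real part -1/2 and 1/2, translation by 1 only flips the sign of the real
    part, so the modulus is kept. *)
Lemma act_T_edgeR : act T edgeR = @edgeL R.
Proof.
apply/seteqP; split=> [_ [z [Hz [Rz nz]] <-]|z [Hz [Rz nz]]].
  rewrite moebiusT; case: z Hz Rz nz => x y /= Hz Rz nz.
  rewrite /edgeL /=; split; rewrite /upper_half_plane /= ?addr0 //.
  split; first by rewrite Rz; lra.
  move: nz; rewrite !normc_def /= addr0 Rz.
  by rewrite (_ : - (1 / 2) + 1 = 1 / 2 :> R) ?sqrrN //; lra.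
exists (z - 1); last by rewrite moebiusT subrK.
case: z Hz Rz nz => x y /= Hz Rz nz.
split; rewrite /upper_half_plane /= ?oppr0 ?addr0 //.
split; first by rewrite Rz; lra.
move: nz; rewrite !normc_def /= oppr0 addr0 Rz.
by rewrite (_ : 1 / 2 - 1 = - (1 / 2) :> R) ?sqrrN //; lra.
Qed.

(** On the unit circle -1/z is minus the complex conjugate of z, the reflection in the imaginary
    axis. *)
Lemma moebiusS (x y : R) : `|x +i* y|%C = 1 ->
  moebius S (x +i* y)%C = (- x +i* y)%C.
Proof.
move=> n1.
have z0 : (x +i* y)%C != 0 by rewrite -normr_eq0 n1 oner_eq0.
rewrite /moebius !mxE /= mul0r add0r mul1r addr0.
apply: (mulIf z0); rewrite divfK //.
have E : x ^+ 2 + y ^+ 2 = 1.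
  have p0 : 0 <= x ^+ 2 + y ^+ 2 by rewrite addr_ge0 ?sqr_ge0.
  move: n1; rewrite normc_def /= => /(congr1 (@complex.Re R)) /= s1.
  by rewrite -(sqr_sqrtr p0) s1 expr1n.
apply/eqP; rewrite eq_complex; apply/andP; split; apply/eqP => /=.
- by rewrite -E; ring.
- by rewrite oppr0; ring.
Qed.

Lemma act_S_edgeB : act S edgeB = @edgeB R.
Proof.
have S_edgeB (x y : R) : edgeB (x +i* y)%C -> edgeB (- x +i* y)%C.
  move=> [Hz [nz Rz]]; split=> //; split; last by rewrite /= normrN.
  by rewrite -nz !normc_def /= sqrrN.
apply/seteqP; split=> [_ [[x y] Bz <-]|[x y] Bz].
  rewrite moebiusS; [exact: S_edgeB | by case: Bz => _ []].
exists (- x +i* y)%C; first exact: S_edgeB.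
by rewrite moebiusS ?opprK //; case: (S_edgeB _ _ Bz) => _ [].
Qed.

(** This puts an [L]-[R] gluing in the form required by [arc_equiv_act], with one common edge. *)
Lemma act_edgeL g : act g edgeL = act (g * T) (@edgeR R).
Proof. by rewrite actM ?act_T_edgeR ?det_mx2 //; exact: edgeR_upper. Qed.

(** The factor [S] turns a lower row (c, d) into (d, -c); applied to one of two [B] arcs, it yields
    the congruences of the gluings. *)
Lemma act_edgeB g : act g edgeB = act (g * S) (@edgeB R).
Proof. by rewrite actM ?act_S_edgeB ?det_mx2 //; exact: edgeB_upper. Qed.

End Arcs.

(* Take for [m] the part of [N] at the primes not dividing [j]: a prime of [N]
   then divides exactly one of the summands [m * c] and [j]. *)
Lemma coprimez_translate (N : nat) (c j : int) : (0 < N)%N -> coprimez c j ->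
  exists m : nat, gcdz (m%:Z * c + j) N = 1.
Proof.
move=> N0 cj; pose pi : nat_pred := [pred p | ~~ (p %| `|j|)%N].
exists (N`_pi)%N; apply/eqP; rewrite /gcdz eqz_nat; apply/negPn/negP.
set g := gcdn _ _ => g1.
have g0 : (0 < g)%N by rewrite gcdn_gt0 absz_nat N0 orbT.
have {g0 g1} [p pP] : exists2 p, prime p & (p %| g)%N.
  by exists (pdiv g); rewrite ?pdiv_dvd // pdiv_prime // ltn_neqAle eq_sym g1.
rewrite dvdn_gcd => /andP [ps pN].
have pNpi : (p %| (N`_pi)%N)%N = ~~ (p %| `|j|)%N.
  have := primes_part pi N => /(congr1 (fun s => p \in s)).
  by rewrite mem_filter !mem_primes pP N0 part_gt0 pN /= andbT.
have {}ps : (p %| (N`_pi)%N%:Z * c + j)%Z by rewrite dvdzE.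
have [pj|pj] := boolP (p %| `|j|)%N; rewrite pj /= in pNpi.
  move: ps; rewrite rpredDr ?dvdzE // abszM Euclid_dvdM //= pNpi /= => pc.
  have : (p %| gcdn `|c| `|j|)%N by rewrite dvdn_gcd pc.
  move: cj; rewrite /coprimez /gcdz eqz_nat => /eqP ->.
  by rewrite dvdn1 => /eqP p1; rewrite p1 in pP.
by move: ps; rewrite rpredDl ?dvdzE ?abszM ?dvdn_mulr //= (negbTE pj).
Qed.

(** With [u = m * c + d] one has [m * c - u = - d]: dividing the point (c : -d) by [u] gives it the
    shape (j' : j' m - 1). *)
Lemma div_translate (R : comUnitRingType) (c d m : R) :
  m * c + d \is a GRing.unit ->
  c / (m * c + d) * m - 1 = - d / (m * c + d).
Proof.
move=> uU; apply: (mulIr uU).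
by rewrite mulrBl mul1r divrK // mulrAC divrK //; ring.
Qed.

(** Both sides are [u - w * c] with [u = m * c + d]. Hence if [w * (c / u) - 1] is a unit, so is the
    translate by [m - w]. *)
Lemma sub_translate (R : comUnitRingType) (c d m w : R) :
  m * c + d \is a GRing.unit ->
  (m - w) * c + d = - ((m * c + d) * (w * (c / (m * c + d)) - 1)).
Proof.
move=> uU; rewrite mulrBr mulr1 mulrCA [_ * (c / _)]mulrC divrK //; ring.
Qed.

(** * Units modulo [N] and the partner arc in 3(b) *)

Section Residues.
Variable N : nat.
Hypothesis N_gt1 : (1 < N)%N.

Lemma unitr_intZp (x : int) :
  ((x%:~R : 'Z_N) \is a GRing.unit) = (gcdz x N%:Z == 1).
Proof.
rewrite /gcdz eqz_nat gcdnC -/(coprime N `|x|) -unitZpE //.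
by case: x => n; rewrite ?NegzE ?abszN // rmorphN unitrN.
Qed.

Lemma gcdz_gt1 (x : int) :
  (1 < gcdz x N%:Z) = ((x%:~R : 'Z_N) \isn't a GRing.unit).
Proof.
rewrite unitr_intZp.
have : (0 < gcdn `|x| N)%N by rewrite gcdn_gt0 (ltnW N_gt1) orbT.
by rewrite /gcdz absz_nat ltz_nat eqz_nat; case: gcdn => [|[]].
Qed.

Lemma intZp_eq0 (x : int) :
  (x%:~R = 0 :> 'Z_N) <-> (x = 0 %[mod N%:Z])%Z.
Proof.
have NR0 : (N%:~R : 'Z_N) = 0 by rewrite -pmulrn pchar_Zp.
rewrite mod0z; split=> [x0|/dvdz_mod0P/dvdzP[q ->]].
  apply/dvdz_mod0P; rewrite dvdzE absz_nat.
  have : (`|x|%:R : 'Z_N) = 0.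
    case: x x0 => n; rewrite ?NegzE ?abszN // rmorphN => /eqP.
    by rewrite oppr_eq0 => /eqP.
  by move=> /(congr1 val) /=; rewrite val_Zp_nat // => /eqP.
by rewrite intrM NR0 mulr0.
Qed.

Lemma tilde_A (x : 'Z_N) : tilde x \in A N.
Proof. by case: ((tildeP x (tilde x) N_gt1).2 erefl). Qed.

Lemma tildeK (x : 'Z_N) : (tilde x)%:~R = x.
Proof. by case: ((tildeP x (tilde x) N_gt1).2 erefl). Qed.

Lemma W_gt0 (j : 'Z_N) : (0 < W j)%N.
Proof. by rewrite /W; case: ex_minnP => m /andP[]. Qed.

Lemma W_unit (j : 'Z_N) : (W j)%:R * j - 1 \is a GRing.unit.
Proof. by rewrite /W; case: ex_minnP => m /andP[]. Qed.

Lemma W_min (j : 'Z_N) m : (0 < m < W j)%N -> m%:R * j - 1 \isn't a GRing.unit.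
Proof.
rewrite /W; case: ex_minnP => w _ min /andP[m0 mw].
apply/negP => mU; have := min m; rewrite m0 mU => /(_ isT); lia.
Qed.

Lemma STSTB_partner (j : int) (m : nat) :
  1 < gcdz j N%:Z -> (1 <= m <= M (j%:~R : 'Z_N))%N ->
  exists (j' : int) (m' : nat),
    [/\ j' \in A N, 1 < gcdz j' N%:Z, (1 <= m' <= M (j'%:~R : 'Z_N))%N &
        (j * j' + (j * m%:Z - 1) * (j' * m'%:Z - 1) = 0 %[mod N%:Z])%Z].
Proof.
rewrite gcdz_gt1 => jN /andP[m1 mM].
have Wm : (0 < m < W (j%:~R : 'Z_N))%N by move: mM; rewrite /M; lia.
set c : 'Z_N := m%:R * j%:~R - 1.
have cN : c \isn't a GRing.unit by exact: W_min.
have exm : exists m' : nat, m'%:R * c + j%:~R \is a GRing.unit.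
  have [|m' /eqP] := @coprimez_translate N (j * m%:Z - 1) j (ltnW N_gt1).
    (* Bézout: [- (j * m - 1) + m * j = 1]. *)
    by apply/coprimezP; exists (-1, m%:Z) => /=; ring.
  rewrite -unitr_intZp => m'U; exists m'.
  by move: m'U; rewrite /c !(intrD, intrM, rmorphN) /= [j%:~R * _]mulrC.
case: (ex_minnP exm) => m' uU min; set u := _ + _ in uU.
pose j' := tilde (c / u); exists j', m'.
have j'E : j'%:~R = c / u by exact: tildeK.
have j'm' : j'%:~R * m'%:R - 1 = - j%:~R / u.
  by rewrite j'E; apply: div_translate.
split; first exact: tilde_A.
- by rewrite gcdz_gt1 j'E unitrMl ?unitrV.
- rewrite j'E; apply/andP; split.
    rewrite lt0n; apply/eqP => m0.
    by move: uU; rewrite /u m0 mul0r add0r (negbTE jN).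
  rewrite /M leqNgt; apply/negP => lt.
  have W0 := W_gt0 (c / u).
  have Wle : (W (c / u) <= m')%N by lia.
  (* The natural subtraction is exact by [Wle], and the smaller translate would again be a unit. *)
  have := min (m' - W (c / u))%N; rewrite natrB //.
  have -> : (m'%:R - (W (c / u))%:R) * c + j%:~R
            = - (u * ((W (c / u))%:R * (c / u) - 1)).
    exact: sub_translate.
  by rewrite unitrN unitrMl ?W_unit // => /(_ uU); lia.
- apply/intZp_eq0; rewrite !(intrD, intrM, rmorphN) /= -!pmulrn.
  (* The sum is now [j * (c / u) + c * (- j / u)]. *)
  rewrite j'm' j'E /c; ring.
Qed.

End Residues.

Theorem theorem1p21 (R : realType) (N : nat) (hN : (1 < N)%N) :
  [/\ arc_equiv N (act (S * T ^ (N2 N)%:Z) (@edgeL R))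
                  (act (S * T ^ (- (N1 N)%:Z)) (@edgeR R)),
      (forall i : int, i \in A N -> gcdz i N%:Z = 1 ->
         arc_equiv N (act (S * T ^ i) (@edgeB R))
                     (act (S * T ^ tilde (- (i%:~R : 'Z_N)^-1)) (@edgeB R))) &
      (forall j : int, j \in A N -> 1 < gcdz j N%:Z ->
         let jN : 'Z_N := j%:~R in
         arc_equiv N
           (act (S * T ^ j * S * T ^+ M jN) (@edgeL R))
           (act (S * T ^ tilde ((1 - jN * (W jN)%:R)^-1 * jN) * S) (@edgeR R))
         /\
         (forall m : nat, (1 <= m <= M jN)%N ->
            let solves (j' : int) (m' : nat) : Prop :=
              [/\ j' \in A N, 1 < gcdz j' N%:Z,
                  (1 <= m' <= M (j'%:~R : 'Z_N))%N &
                  (j * j' + (j * m%:Z - 1) * (j' * m'%:Z - 1) = 0 %[mod N%:Z])%Z] in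
            (exists j' m', solves j' m') /\
            (forall j' m', solves j' m' ->
               arc_equiv N (act (S * T ^ j * S * T ^+ m) (@edgeB R))
                           (act (S * T ^ j' * S * T ^+ m') (@edgeB R)))))].
Proof.
split.
- rewrite act_edgeL !ST_expz mul_mx2.
  apply: arc_equiv_act; [lia | lia | | exact: edgeR_upper].
  apply/eqP; rewrite eqz_mod_dvd subr0.
  (* The lower rows are (1, N2 + 1) and (1, -N1), and [N1 + N2 + 1 = N]. *)
  rewrite (_ : _ - _ = - N%:Z) ?dvdzE ?abszN //.
  rewrite /N1 /N2; lia.
- move=> i _ iN; rewrite act_edgeB !ST_expz mul_mx2.
  apply: arc_equiv_act; [lia | lia | | exact: edgeB_upper].
  apply/intZp_eq0 => //.
  have iU : (i%:~R : 'Z_N) \is a GRing.unit by rewrite unitr_intZp ?iN.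
  (* The lower rows are (i, -1) and (1, t), with t representing the inverse of -i; their determinant
     is [i * t + 1]. *)
  rewrite !(intrD, intrM, rmorphN) /= tildeK //.
  rewrite mulr0 mulr1 add0r mul1r mulr1 mulrN mulrV //; ring.
- move=> j _ jN1 jN; split.
    rewrite act_edgeL exprnP STS_expz ST_expz !mul_mx2.
    apply: arc_equiv_act; [nia | nia | | exact: edgeR_upper].
    set t := tilde _.
    (* The factor [T] raises the exponent [M jN] to [W jN], so the lower rows are (j, j W - 1) and
       (t, -1). *)
    have WM : (W jN)%:Z = (M jN)%:Z + 1 by have := W_gt0 _ jN; rewrite /M; lia.
    rewrite (_ : _ - _ = t * (1 - j * (W jN)%:Z) - j); last by rewrite WM; ring.
    have wU : 1 - jN * (W jN)%:R \is a GRing.unit.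
      by rewrite -unitrN opprB mulrC W_unit.
    apply/intZp_eq0 => //.
    rewrite intrB intrM tildeK // intrB intrM -/jN -pmulrn.
    by rewrite mulrAC mulVr // mul1r subrr.
move=> m mM solves; split; first exact: STSTB_partner.
move=> j' m' [_ _ _ jj'].
(* The lower rows become (j m - 1, -j) and (j', j' m' - 1), whose determinant is the left side of
   the assumed congruence. *)
rewrite act_edgeB !exprnP !STS_expz mul_mx2.
apply: arc_equiv_act; [nia | nia | | exact: edgeB_upper].
rewrite -jj'; congr modz; ring.
Qed.
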